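(* A positive integer $n$ is an $i$-congruent number if and only if at least one of the following holds: (1) there exist an odd prime $p$ and an integer $k\ge \frac{p^2-1}{4}$ such that $n=pk$; (2) there exist an integer $i\ge 1$ and an odd integer $k\ge 2^{2i}-1$ such that $n=2^ik$.
   Context: A positive integer $n$ is called an $i$-congruent number if it is the area of a right trapezoid with parallel sides $a>d$, height $b$ (perpendicular to the parallel sides) and slanted side $c$, where $a,b,c$ are positive integers, $d$ is a non-negative integer ($d=0$, a right triangle, is allowed) and $\gcd(b,c)=1$. Equivalently: there exist positive integers $a,b,c$ and an integer $d$ with $0\le d<a$ such that $n=\frac{(a+d)b}{2}$, $(a-d)^2+b^2=c^2$ and $\gcd(b,c)=1$. (The letter $i$ in the term ''$i$-congruent'' is part of the name and is not a parameter.) *)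

(* Defs.v *)
From mathcomp Require Import all_boot.

Set Implicit Arguments.
Unset Strict Implicit.
Unset Printing Implicit Defensive.

(* A right trapezoid with parallel sides a > d (d = 0 gives a right triangle),
   height b and slanted side c.  Since d < a, the truncated subtraction a - d
   is the genuine difference, i.e. the other leg of the right triangle with
   leg b and hypotenuse c. *)
Definition right_trapezoid (a b c d : nat) : Prop :=
  [/\ 0 < b, 0 < c, d < a & (a - d) ^ 2 + b ^ 2 = c ^ 2].

(* The area condition n = (a + d) * b / 2 is written without division: the
   quotient need not be an integer, and %/ would round it down. *)
Definition i_congruent (n : nat) : Prop :=
  exists a b c d : nat,
    [/\ right_trapezoid a b c d, 2 * n = (a + d) * b & coprime b c].

(* Main.v *)
Require Import Defs.
From mathcomp Require Import all_boot.
From mathcomp Require Import zify.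

(** Put x = a - d, so that x, b, c is a Pythagorean triple, primitive because b
    and c are coprime, and the area satisfies 2 n = (x + 2 d) b.

    If n = p k with p an odd prime, the triple ((p^2 - 1)/2, p, (p^2 + 1)/2)
    has height p, and the right triangle on it has area p (p^2 - 1)/4; letting
    d grow by one adds p to the area, so every k >= (p^2 - 1)/4 is reached.  If
    n = 2^i k with k odd, the triple (4^i - 1, 2^(i+1), 4^i + 1) works in the
    same way: as d varies, x + 2 d runs through all odd k >= 4^i - 1.

    Conversely, a trapezoid factors a square as (c + x)(c - x) = b^2.  When b
    is odd take u = c + x, v = c - x and any prime p dividing b, with j = 1;
    when b is even halve everything, u = (c + x)/2, v = (c - x)/2, u v =
    (b/2)^2, and take p = 2 with p^j the exact power of 2 in b/2.  In both cases
    p cannot divide u and v simultaneously, so the whole of p^(2j) sits in one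
    of them.  Writing the square root of u v as p^j m, this forces the gap u - v
    to be so large that m (u - v) >= p^(2j) - 1 ([square_split_gap]), and this
    is the lower bound on k, since m (u - v) is bounded by 4 k in the odd case
    and by k in the even case. *)

(** The case where P^2 divides the larger factor P^2 w: P w exceeds m by some
    e >= 1, and w m z = m e (2 m + e).  Since m e >= m + e - 1, this product is
    at least (m + e)^2 - 1 = (P w)^2 - 1 >= w (P^2 - 1). *)
Lemma gap_larger_factor (P m v w z : nat) :
  0 < m -> 0 < z -> m ^ 2 = w * v -> P ^ 2 * w = v + z -> P ^ 2 - 1 <= m * z.
Proof.
move=> m0 z0 Em Ev.
have w0 : 0 < w by nia.
have mlt : m < P * w by rewrite -(ltn_sqr m); nia.
have [e e0 Ee] : exists2 e, 0 < e & P * w = m + e.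
  by exists (P * w - m); lia.
have Ez : w * (m * z) = m * e * (2 * m + e) by nia.
have me : m + e <= m * e + 1 by nia.
have H : (m + e) ^ 2 <= m * e * (2 * m + e) + 1 by nia.
rewrite -(leq_pmul2l w0) Ez.
rewrite -Ee in H; nia.
Qed.

(** The case where P^2 divides the smaller factor P^2 w: now m exceeds P w by
    some e >= 1, and w m z = m e (m + P w) >= (P w)^2 >= w P^2. *)
Lemma gap_smaller_factor (P m u w z : nat) :
  0 < w -> 0 < z -> m ^ 2 = w * u -> u = P ^ 2 * w + z -> P ^ 2 - 1 <= m * z.
Proof.
move=> w0 z0 Em Eu.
have mlt : P * w < m by rewrite -(ltn_sqr _ m); nia.
have [e e0 Ee] : exists2 e, 0 < e & m = P * w + e.
  by exists (m - P * w); lia.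
have Ez : w * (m * z) = m * e * (m + P * w) by nia.
rewrite -(leq_pmul2l w0) Ez.
have : (P * w) * (P * w) <= m * e * (m + P * w) by apply: leq_mul; nia.
nia.
Qed.

Lemma prime_power_dvd_one_factor (p j u v : nat) :
  prime p -> ~~ ((p %| u) && (p %| v)) -> p ^ j %| u * v ->
  (p ^ j %| u) || (p ^ j %| v).
Proof.
move=> pp; rewrite negb_and => /orP[] pN.
  by rewrite Gauss_dvdr ?coprimeXl ?prime_coprime // => ->; rewrite orbT.
by rewrite Gauss_dvdl ?coprimeXl ?prime_coprime // => ->.
Qed.

(** The factor prime to p is coprime to p^(2j), so p^(2j) divides the other
    one; the bound then depends on whether that is the larger or the smaller. *)
Lemma square_split_gap (p j m u v : nat) :
  prime p -> ~~ ((p %| u) && (p %| v)) -> 0 < v -> v < u ->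
  (p ^ j * m) ^ 2 = u * v -> (p ^ j) ^ 2 - 1 <= m * (u - v).
Proof.
move=> pp pN v0 vu E.
have P0 : 0 < (p ^ j) ^ 2 by rewrite !expn_gt0 prime_gt0.
have uv0 : 0 < u * v by rewrite muln_gt0 v0 (leq_ltn_trans _ vu).
have m0 : 0 < m by case: m E => // E; rewrite muln0 in E; lia.
have : p ^ (j * 2) %| u * v by rewrite -E expnM expnMn dvdn_mulr.
move/(prime_power_dvd_one_factor _ _ _ _ pp pN); rewrite expnM.
move=> /orP[] /dvdnP[w Ew]; rewrite expnMn in E.
- apply: (@gap_larger_factor _ _ v w) => //; rewrite ?subn_gt0 //; last lia.
  by apply/eqP; rewrite -(eqn_pmul2l P0); apply/eqP; rewrite E Ew; lia.
- apply: (@gap_smaller_factor _ _ u w); rewrite ?subn_gt0 //; last lia.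
    by case: w Ew v0 => // ->.
  by apply/eqP; rewrite -(eqn_pmul2l P0); apply/eqP; rewrite E Ew; lia.
Qed.

(** The excluded case of two odd legs would give a sum of squares congruent to
    2 modulo 4. *)
Lemma odd_leg_other_even (x b c : nat) :
  x ^ 2 + b ^ 2 = c ^ 2 -> odd b -> ~~ odd x.
Proof.
move=> E ob; apply/negP => ox.
have ec : ~~ odd c by have := congr1 odd E; rewrite oddD !oddX ox ob /= => <-.
have [y Ey] : exists y, x = 2 * y + 1 by exists x./2; lia.
have [f Ef] : exists f, b = 2 * f + 1 by exists b./2; lia.
have [g Eg] : exists g, c = 2 * g by exists c./2; lia.
subst; lia.
Qed.

(** A common prime factor of c + x and c - x divides 2 c, and it also divides b
    once it is chosen as a factor of b; being odd, it would divide both b and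
    c. *)
Lemma triple_odd_height (x b c : nat) :
  0 < x -> odd b -> x ^ 2 + b ^ 2 = c ^ 2 -> coprime b c ->
  exists p m, [/\ prime p, odd p, b = p * m & p ^ 2 - 1 <= m * (2 * x)].
Proof.
move=> x0 ob E cop.
have b0 : 0 < b by case: b ob {E cop}.
have xc : x < c by rewrite -(ltn_sqr x) -E; nia.
have b1 : 1 < b.
  rewrite ltn_neqAle b0 andbT eq_sym; apply/eqP => b1; nia.
have pp := pdiv_prime b1; have pb := pdiv_dvd b.
move: (pdiv b) pp pb => p pp pb.
have op : odd p := dvdn_odd pb ob.
have /dvdnP[m Em] := pb.
exists p, m; split=> //; first by rewrite mulnC.
have -> : 2 * x = (c + x) - (c - x) by lia.
have Euv : (p ^ 1 * m) ^ 2 = (c + x) * (c - x).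
  by rewrite expn1 (mulnC p) -Em mulnC -subn_sqr -E addKn.
rewrite -{1}[p]expn1; apply: square_split_gap => //; try lia.
apply/negP => /andP[pu pv].
have := dvdn_add pu pv; have -> : (c + x) + (c - x) = 2 * c by lia.
rewrite Gauss_dvdr ?coprimen2 // => pc.
have : p %| gcdn b c by rewrite dvdn_gcd pb.
by rewrite (eqP cop) dvdn1 => /eqP p1; rewrite p1 in pp.
Qed.

(** Here (c + x)/2 and (c - x)/2 have the odd sum c, so that exactly one of them
    is even; this both puts every factor 2 of their product in one place and
    forces h to be even. *)
Lemma triple_even_height (x h c : nat) :
  0 < x -> 0 < h -> x ^ 2 + (2 * h) ^ 2 = c ^ 2 -> coprime (2 * h) c ->
  exists i m, [/\ 1 <= i, odd m, odd x, h = 2 ^ i * m & 2 ^ (2 * i) - 1 <= m * x].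
Proof.
move=> x0 h0 E; rewrite coprimeMl coprime2n => /andP[oc _].
have ox : odd x by have := congr1 odd E; rewrite oddD !oddX oddM oc; case: odd.
have xc : x < c by rewrite -(ltn_sqr x) -E; nia.
have [v Ev] : exists v, c = x + 2 * v by exists (c - x)./2; lia.
have v0 : 0 < v by lia.
have Eh : h ^ 2 = (x + v) * v by subst c; nia.
have [m om Em] := @pfactor_coprime 2 h isT h0.
rewrite coprime2n in om.
exists (logn 2 h), m; split=> //.
- have eh : ~~ odd h.
    have := congr1 odd Eh; rewrite oddX oddM oddD ox /= => ->.
    by case: (odd v).
  by rewrite -pfactor_dvdn // expn1 dvdn2.
- by rewrite mulnC.
- rewrite mulnC expnM; have -> : x = (x + v) - v by lia.
  by apply: square_split_gap => //; lia.
Qed.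

Lemma i_congruent_of_odd_prime (p k : nat) :
  prime p -> odd p -> (p ^ 2 - 1) %/ 4 <= k -> i_congruent (p * k).
Proof.
move=> pp op; have p1 := prime_gt1 pp.
have [q Eq] : exists q, p = 2 * q + 1 by exists p./2; lia.
have q0 : 0 < q by lia.
have [s Es] : exists s, q * (q + 1) = 2 * s.
  by exists (q * (q + 1))./2; have := oddM q (q + 1); rewrite oddD; lia.
have s0 : 0 < s by nia.
(* With p = 2 q + 1, the even leg (p^2 - 1)/2 is 2 q (q + 1) = 4 s. *)
have -> : (p ^ 2 - 1) %/ 4 = 2 * s.
  have -> : p ^ 2 - 1 = (2 * s) * 4 by subst p; nia.
  by rewrite mulnK.
move=> sk.
exists (4 * s + (k - 2 * s)), p, (4 * s + 1), (k - 2 * s); split.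
- by split; lia.
- nia.
- have : coprime p (2 * (4 * s + 1)).
    have -> : 2 * (4 * s + 1) = p * p + 1 by subst p; nia.
    by rewrite /coprime gcdnMDl gcdn1.
  by rewrite coprimeMr => /andP[].
Qed.

Lemma i_congruent_of_two_power (i k : nat) :
  1 <= i -> odd k -> 2 ^ (2 * i) - 1 <= k -> i_congruent (2 ^ i * k).
Proof.
move=> i1 ok; rewrite mulnC expnM.
have eQ : ~~ odd (2 ^ i) by rewrite oddX negb_or -lt0n i1.
have oc : odd ((2 ^ i) ^ 2 + 1) by rewrite oddD oddX (negbTE eQ).
have Q1 : 1 < 2 ^ i by rewrite -{1}(expn0 2) ltn_exp2l.
have cop : coprime (2 * 2 ^ i) ((2 ^ i) ^ 2 + 1).
  by rewrite coprimeMl coprimeXl ?coprime2n ?oc.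
move: (2 ^ i) eQ oc Q1 cop => Q eQ oc Q1 cop xk.
have ox : odd (Q ^ 2 - 1) by rewrite oddB ?oddX ?(negbTE eQ) //; nia.
have [d Ed] : exists d, k = Q ^ 2 - 1 + 2 * d.
  by exists (k - (Q ^ 2 - 1))./2; lia.
exists (Q ^ 2 - 1 + d), (2 * Q), (Q ^ 2 + 1), d; split=> //.
- by split; nia.
- by rewrite Ed; lia.
Qed.

Theorem proposition1p1 (n : nat) (n_gt0 : 0 < n) :
  i_congruent n <->
  (exists p k : nat,
     [/\ prime p, odd p, (p ^ 2 - 1) %/ 4 <= k & n = p * k])
  \/
  (exists i k : nat,
     [/\ 1 <= i, odd k, 2 ^ (2 * i) - 1 <= k & n = 2 ^ i * k]).
Proof.
split=> [[a [b [c [d [[b0 c0 da]]]]]] | [[p [k [pp op pk ->]]] | [i [k [i1 ok ik ->]]]]];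
  last 2 first.
- exact: i_congruent_of_odd_prime.
- exact: i_congruent_of_two_power.
have [x x0 ->] : exists2 x, 0 < x & a = x + d by exists (a - d); lia.
rewrite addnK => E En cop.
have [ob|eb] := boolP (odd b).
- left; have ex := odd_leg_other_even _ _ _ E ob.
  have [y Ey] : exists y, x = 2 * y by exists x./2; lia.
  have [p [m [pp op Eb gap]]] := triple_odd_height _ _ _ x0 ob E cop.
  exists p, (m * (y + d)); split=> //.
    apply: (@leq_trans (m * (2 * x) %/ 4)); first exact: leq_div2r.
    have -> : m * (2 * x) = (m * y) * 4 by rewrite Ey; lia.
    by rewrite mulnK // leq_mul // leq_addr.
  subst; nia.
- right; have [h Eh] : exists h, b = 2 * h by exists b./2; lia.
  have h0 : 0 < h by lia.
  rewrite Eh in E cop.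
  have [i [m [i1 om ox Ehm gap]]] := triple_even_height _ _ _ x0 h0 E cop.
  exists i, (m * (x + 2 * d)); split=> //.
  + by rewrite oddM om oddD ox oddM.
  + by apply: (leq_trans gap); rewrite leq_mul // leq_addr.
  + move: (2 ^ i) Ehm => Q Ehm; subst; nia.
Qed.
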